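(* Let $(\mathfrak{g},[\cdot,\cdot],\alpha)$ be a multiplicative Hom-Lie superalgebra, and let $D:\mathfrak{g}\to\mathfrak{g}$ be an $\alpha^k$-derivation of $\mathfrak{g}$, where $k\ge 0$. For $n\ge2$ let $[x_1,x_2]_2=[x_1,x_2]$, let $[x_1,\ldots,x_n]_n=\bigl[[x_1,\ldots,x_{n-1}]_{n-1},\alpha^{n-2}(x_n)\bigr]$ for $n\ge3$, and let $\beta_n=\alpha^{n-1}$. Then $D$ commutes with $\beta_n$ and satisfies $$D([x_1,\ldots,x_n]_n)=\sum_{i=1}^{n}(-1)^{|D|(|x_1|+\cdots+|x_{i-1}|)}[\alpha^k(x_1),\ldots,\alpha^k(x_{i-1}),D(x_i),\alpha^k(x_{i+1}),\ldots,\alpha^k(x_n)]_n$$ for all homogeneous $x_1,\ldots,x_n\in\mathfrak{g}$.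
   Context: Vector spaces are over a field $\mathbb{K}$ of characteristic zero. A multiplicative Hom-Lie superalgebra $(\mathfrak{g},[\cdot,\cdot],\alpha)$ is a $\mathbb{Z}_2$-graded space $\mathfrak{g}=\mathfrak{g}_{\bar0}\oplus\mathfrak{g}_{\bar1}$ with an even bilinear bracket ($[\mathfrak{g}_{\bar i},\mathfrak{g}_{\bar j}]\subseteq\mathfrak{g}_{\bar i+\bar j}$) and an even (grading-preserving) linear map $\alpha$ such that $\alpha([x,y])=[\alpha(x),\alpha(y)]$ for all $x,y$ and, for homogeneous $x,y,z$ of parities $|x|,|y|,|z|$: $[x,y]=-(-1)^{|x||y|}[y,x]$ and $\sum_{\circlearrowleft_{x,y,z}}(-1)^{|x||z|}[\alpha(x),[y,z]]=0$ (sum over cyclic permutations of $x,y,z$). An $\alpha^k$-derivation of $\mathfrak{g}$ is a homogeneous linear map $D$ of parity $|D|\in\mathbb{Z}_2$ (i.e. $D(\mathfrak{g}_{\bar i})\subseteq\mathfrak{g}_{\bar i+|D|}$) with $D\circ\alpha=\alpha\circ D$ and $D([x,y])=[D(x),\alpha^k(y)]+(-1)^{|D||x|}[\alpha^k(x),D(y)]$ for homogeneous $x,y$, where $\alpha^0=\mathrm{id}$. *)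

(* Defs.v *)
From mathcomp Require Import all_boot all_order all_algebra.

Set Implicit Arguments.
Unset Strict Implicit.
Unset Printing Implicit Defensive.

Import GRing.Theory.
Local Open Scope ring_scope.

(* Parities live in 'Z_2, so that products and sums of parities are computed
   modulo 2 before being used as an exponent of -1. *)
Definition parity_sign (K : fieldType) (a : 'Z_2) : K := (-1) ^+ (a : nat).

(* V is the direct sum of its subspaces gr 0 and gr 1.  A homogeneous element
   of parity a is an element of gr a; the zero vector has both parities. *)
Record is_superspace (K : fieldType) (V : lmodType K)
    (gr : 'Z_2 -> {pred V}) : Prop := IsSuperspace {
  superspace_submod : forall a, submod_closed (gr a);
  superspace_sum : forall x, exists x0 x1,
    [/\ x0 \in gr 0, x1 \in gr 1 & x = x0 + x1];
  superspace_direct : forall x, x \in gr 0 -> x \in gr 1 -> x = 0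
}.

Record is_mult_hom_Lie_superalgebra (K : fieldType) (V : lmodType K)
    (gr : 'Z_2 -> {pred V}) (br : {bilinear V -> V -> V})
    (alpha : {linear V -> V}) : Prop := IsMultHomLieSuperalgebra {
  hls_superspace : is_superspace gr;
  hls_bracket_even : forall a b x y,
    x \in gr a -> y \in gr b -> br x y \in gr (a + b);
  hls_twist_even : forall a x, x \in gr a -> alpha x \in gr a;
  hls_mult : forall x y, alpha (br x y) = br (alpha x) (alpha y);
  hls_skew : forall a b x y, x \in gr a -> y \in gr b ->
    br x y = - (parity_sign K (a * b) *: br y x);
  hls_jacobi : forall a b c x y z, x \in gr a -> y \in gr b -> z \in gr c ->
    parity_sign K (a * c) *: br (alpha x) (br y z)
    + parity_sign K (b * a) *: br (alpha y) (br z x)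
    + parity_sign K (c * b) *: br (alpha z) (br x y) = 0
}.

Record is_alpha_derivation (K : fieldType) (V : lmodType K)
    (gr : 'Z_2 -> {pred V}) (br : {bilinear V -> V -> V})
    (alpha : {linear V -> V}) (k : nat)
    (D : {linear V -> V}) (d : 'Z_2) : Prop := IsAlphaDerivation {
  ader_homogeneous : forall a x, x \in gr a -> D x \in gr (a + d);
  ader_twist : forall x, D (alpha x) = alpha (D x);
  ader_leibniz : forall a b x y, x \in gr a -> y \in gr b ->
    D (br x y) = br (D x) (iter k alpha y)
                 + parity_sign K (d * a) *: br (iter k alpha x) (D y)
}.

(* nbracket br alpha m is the bracket of arity n = m.+2 (so n >= 2), with
   x_1, ..., x_n indexed from 0; the recursion uses n - 2 = m and the
   restriction of x to its first n - 1 arguments. *)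
Fixpoint nbracket (K : fieldType) (V : lmodType K)
    (br : {bilinear V -> V -> V}) (alpha : {linear V -> V}) (m : nat) :
    ('I_m.+2 -> V) -> V :=
  match m return ('I_m.+2 -> V) -> V with
  | 0 => fun x => br (x ord0) (x ord_max)
  | m'.+1 => fun x =>
      br (nbracket br alpha (fun i : 'I_m'.+2 => x (widen_ord (leqnSn _) i)))
         (iter m'.+1 alpha (x ord_max))
  end.

(* beta_n, where n is the arity itself (unlike the index of nbracket). *)
Definition ntwist (K : fieldType) (V : lmodType K)
    (alpha : {linear V -> V}) (n : nat) : V -> V := iter (n - 1)%N alpha.

(* Main.v *)
Require Import Defs.
From mathcomp Require Import all_boot all_order all_algebra.
Import GRing.Theory.
Local Open Scope ring_scope.

(** The n-ary bracket is a left-nested iteration of the binary one, so the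
    statement follows by induction on the arity.  Writing
    [x_1, ..., x_(n+1)] as the binary bracket of N = [x_1, ..., x_n] with
    alpha^(n-1)(x_(n+1)), the binary Leibniz rule gives two terms.

    In the first, D falls on N: the induction hypothesis expands D N, and
    bilinearity distributes the outer bracket, which yields the summands where
    D hits one of the first n arguments (the signs only involve arguments to
    the left of the one hit, so the new argument does not alter them).

    In the second, D falls on the last factor, N becomes alpha^k N, and the sign
    is governed by |N|.  It is the remaining summand because of three facts:
    |N| = |x_1| + ... + |x_n| since the bracket and alpha are even
    ([nbracket_homogeneous]); alpha^k N is the bracket of the alpha^k x_j since
    alpha is multiplicative ([iter_twist_nbracket]); and D commutes with
    the powers of alpha ([alpha_derivation_iter]). *)

(** Reindexed families of arguments, such as a restriction of the case split on
    [j == i], agree only pointwise; this lemma replaces functional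
    extensionality when they are compared. *)
Lemma eq_nbracket (K : fieldType) (V : lmodType K)
    (br : {bilinear V -> V -> V}) (alpha : {linear V -> V})
    (m : nat) (x y : 'I_m.+2 -> V) :
  x =1 y -> nbracket br alpha x = nbracket br alpha y.
Proof.
elim: m x y => [|m IHm] x y eq_xy /=; first by rewrite !eq_xy.
by rewrite eq_xy; congr (br _ _); apply: IHm => i; apply: eq_xy.
Qed.

Lemma iter_swap (T : Type) (f : T -> T) (a b : nat) (v : T) :
  iter a f (iter b f v) = iter b f (iter a f v).
Proof. by rewrite -!iterD addnC. Qed.

Section HomLieSuperalgebra.

Context {K : fieldType} {V : lmodType K} {gr : 'Z_2 -> {pred V}}.
Context {br : {bilinear V -> V -> V}} {alpha : {linear V -> V}}.
Context (hV : is_mult_hom_Lie_superalgebra gr br alpha).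

Lemma iter_twist_even (k : nat) (a : 'Z_2) (x : V) :
  x \in gr a -> iter k alpha x \in gr a.
Proof. by move=> xa; elim: k => //= k; apply: (hls_twist_even hV). Qed.

Lemma iter_twist_bracket (k : nat) (x y : V) :
  iter k alpha (br x y) = br (iter k alpha x) (iter k alpha y).
Proof. by elim: k => //= k ->; rewrite (hls_mult hV). Qed.

(** The powers of alpha inside the bracket do not contribute to its parity,
    because alpha is even. *)
Lemma nbracket_homogeneous (m : nat) (x : 'I_m.+2 -> V) (p : 'I_m.+2 -> 'Z_2) :
  (forall i, x i \in gr (p i)) ->
  nbracket br alpha x \in gr (\sum_(i < m.+2) p i).
Proof.
elim: m x p => [|m IHm] x p hx.
  rewrite big_ord_recr big_ord1 /=.
  have -> : widen_ord (leqnSn 1) ord0 = ord0 by apply: val_inj.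
  exact: (hls_bracket_even hV).
rewrite big_ord_recr; apply: (hls_bracket_even hV).
  exact: (IHm _ (fun i => p (widen_ord _ i))).
exact: (iter_twist_even m.+1).
Qed.

(** Multiplicativity moves alpha^k through each binary bracket; past the powers
    of alpha that the recursion puts on its right factors, alpha^k commutes. *)
Lemma iter_twist_nbracket (k m : nat) (x : 'I_m.+2 -> V) :
  iter k alpha (nbracket br alpha x) =
  nbracket br alpha (fun i => iter k alpha (x i)).
Proof.
elim: m x => [|m IHm] x; first exact: iter_twist_bracket.
by rewrite [LHS]iter_twist_bracket IHm iter_swap.
Qed.

Section AlphaDerivation.

Context {k : nat} {D : {linear V -> V}} {d : 'Z_2}.
Context (hD : is_alpha_derivation gr br alpha k D d).

Lemma alpha_derivation_iter (l : nat) (v : V) :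
  D (iter l alpha v) = iter l alpha (D v).
Proof. by elim: l => //= l <-; rewrite (ader_twist hD). Qed.

Lemma alpha_derivation_nbracket (m : nat) (x : 'I_m.+2 -> V)
    (p : 'I_m.+2 -> 'Z_2) :
  (forall i, x i \in gr (p i)) ->
  D (nbracket br alpha x) =
    \sum_(i < m.+2)
      parity_sign K (d * \sum_(j < m.+2 | (j < i)%N) p j) *:
        nbracket br alpha
          (fun j => if j == i then D (x j) else iter k alpha (x j)).
Proof.
elim: m x p => [|m IHm] x p hx.
  rewrite (ader_leibniz hD (hx _) (hx _)) big_ord_recr big_ord1 /=.
  rewrite big_pred0 // mulr0 scale1r (big_pred1 ord0) // => j.
  by rewrite /= ltnS leqn0.
pose w := widen_ord (leqnSn m.+2).
rewrite [nbracket _ _ x]/=.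
rewrite (ader_leibniz hD (nbracket_homogeneous m _ (p \o w) (fun i => hx (w i)))
  (iter_twist_even m.+1 _ _ (hx ord_max))).
rewrite [RHS]big_ord_recr (IHm _ (p \o w) (fun i => hx (w i))) linear_sumlz.
congr (_ + _).
  (* D hits an argument of the inner bracket: the last index is larger than i,
     hence absent from the sign, and its argument receives alpha^k. *)
  apply: eq_bigr => i _; rewrite linearZl_LR [in RHS]/=.
  congr (parity_sign K (d * _) *: _).
    rewrite [RHS]big_mkcond [RHS]big_ord_recr [LHS]big_mkcond /=.
    by rewrite ltnNge ltnW // addr0.
  rewrite -val_eqE /= gtn_eqF // -!iterS iter_swap.
  by congr (br _ _); apply: eq_nbracket.
(* D hits the last argument: every other index precedes it, so the sign sees
   the full parity of the inner bracket. *)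
congr (parity_sign K (d * _) *: _).
  rewrite [RHS]big_mkcond [RHS]big_ord_recr /= ltnn addr0.
  by apply: eq_bigr => i _; rewrite ltn_ord.
rewrite [RHS]/= eqxx iter_twist_nbracket alpha_derivation_iter.
congr (br _ _); apply: eq_nbracket => i.
by rewrite -val_eqE /= ltn_eqF.
Qed.

End AlphaDerivation.

End HomLieSuperalgebra.

Theorem proposition3p25 (K : fieldType) (charK0 : [pchar K] =i pred0)
    (V : lmodType K) (gr : 'Z_2 -> {pred V})
    (br : {bilinear V -> V -> V}) (alpha : {linear V -> V})
    (hV : is_mult_hom_Lie_superalgebra gr br alpha)
    (k : nat) (D : {linear V -> V}) (d : 'Z_2)
    (hD : is_alpha_derivation gr br alpha k D d)
    (m : nat) (n := m.+2) :
  (forall v : V, D (ntwist alpha n v) = ntwist alpha n (D v)) /\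
  (forall (x : 'I_n -> V) (p : 'I_n -> 'Z_2),
     (forall i : 'I_n, x i \in gr (p i)) ->
     D (nbracket br alpha x) =
       \sum_(i < n)
         parity_sign K (d * \sum_(j < n | (j < i)%N) p j) *:
           nbracket br alpha
             (fun j : 'I_n => if j == i then D (x j) else iter k alpha (x j))).
Proof.
split; first exact: (alpha_derivation_iter hD).
exact: (alpha_derivation_nbracket hV hD).
Qed.
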